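(* Let $I$ be a non-empty set of unary connective symbols disjoint from $\{\vee,\to,\cdot,0,1\}$. The logic $S_{\mathcal{H}}$ has the local deduction-detachment theorem: there exists a family $\{d_j(p,q)\colon j\in J\}$ of sets $d_j(p,q)$ of formulas in at most two variables such that for every set $\Gamma\cup\{\varphi,\psi\}$ of formulas in the language of $S_{\mathcal{H}}$, $$\Gamma,\varphi\vdash_{S_{\mathcal{H}}}\psi\iff\Gamma\vdash_{S_{\mathcal{H}}}d_j(\varphi,\psi)\ \text{for some}\ j\in J.$$
   Context: Formulas are over a countably infinite set of variables in the language $\{\vee,\to,\cdot,0,1\}\cup I$. Write $\bot$ for the constant $0$, and $\top:=\bot\to\bot$; the constant $1$ is identified with $\top$. A statement $\varphi\leftrightarrow\psi$ abbreviates the two formulas $\varphi\to\psi$ and $\psi\to\varphi$. The Hilbert calculus $\mathcal{H}$ has the axiom schemes: (1) $\varphi\to\varphi$; (2) $(\varphi\to\psi)\to[(\psi\to\chi)\to(\varphi\to\chi)]$; (3) $\varphi\cdot\psi\to\varphi$; (4) $\varphi\cdot\psi\to\psi\cdot\varphi$; (5) $[(\varphi\cdot\psi)\to\chi]\to[\psi\to(\varphi\to\chi)]$; (6) $[\psi\to(\varphi\to\chi)]\to[(\varphi\cdot\psi)\to\chi]$; (7) $\varphi\to(\varphi\vee\psi)$; (8) $\psi\to(\varphi\vee\psi)$; (9) $\varphi\cdot(\psi\vee\chi)\to[(\varphi\cdot\psi)\vee(\varphi\cdot\chi)]$; (10) $\bot\to\varphi$; and, for every $m\in I$, ($m$11)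 $m(\top)\leftrightarrow\top$; ($m$12) $m(\varphi\to\psi)\to(m(\varphi)\to m(\psi))$. Its rules are: from $\varphi\to\psi$ and $\varphi$ infer $\psi$; from $\varphi$ infer $m(\varphi)$ (for every $m\in I$); from $\varphi\to\chi$ and $\psi\to\chi$ infer $(\varphi\vee\psi)\to\chi$. $\Gamma\vdash_{S_{\mathcal{H}}}\varphi$ means that there is a finite $\mathcal{H}$-deduction of $\varphi$ from finitely many formulas of $\Gamma$ (rules applicable to any previously derived formulas). $\Gamma\vdash_{S_{\mathcal{H}}}d$ for a set $d$ of formulas means that $\Gamma\vdash_{S_{\mathcal{H}}}\chi$ for all $\chi\in d$; $d_j(\varphi,\psi)$ is the result of substituting $\varphi$ for $p$ and $\psi$ for $q$; $\Gamma,\varphi$ stands for $\Gamma\cup\{\varphi\}$. *)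

(* Defs.v *)
From Stdlib Require Export Ensembles Finite_sets Image List.

Set Implicit Arguments.

(** Formulas over the countably infinite set [nat] of variables, with a unary
    connective [Mod m] for every [m : I].  There is no separate constructor for
    the constant 1: it is identified with [Top], i.e. [Bot --> Bot]. *)
Inductive formula (I : Type) : Type :=
| Var : nat -> formula I
| Bot : formula I
| Or : formula I -> formula I -> formula I
| Imp : formula I -> formula I -> formula I
| Dot : formula I -> formula I -> formula I
| Mod : I -> formula I -> formula I.

Arguments Var {I} _.
Arguments Bot {I}.

Declare Scope formula_scope.
Delimit Scope formula_scope with F.
Bind Scope formula_scope with formula.
Infix "*" := Dot : formula_scope.
Infix "||" := Or : formula_scope.
Infix "-->" := Imp (at level 55, right associativity) : formula_scope.
Local Open Scope formula_scope.

Definition Top {I : Type} : formula I := Bot --> Bot.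

Inductive axiom (I : Type) : formula I -> Prop :=
| ax1 f : axiom (f --> f)
| ax2 f g h : axiom ((f --> g) --> ((g --> h) --> (f --> h)))
| ax3 f g : axiom (f * g --> f)
| ax4 f g : axiom (f * g --> g * f)
| ax5 f g h : axiom ((f * g --> h) --> (g --> (f --> h)))
| ax6 f g h : axiom ((g --> (f --> h)) --> (f * g --> h))
| ax7 f g : axiom (f --> f || g)
| ax8 f g : axiom (g --> f || g)
| ax9 f g h : axiom (f * (g || h) --> (f * g) || (f * h))
| ax10 f : axiom (Bot --> f)
| ax11_l m : axiom (Mod m Top --> Top)
| ax11_r m : axiom (Top --> Mod m Top)
| ax12 m f g : axiom (Mod m (f --> g) --> (Mod m f --> Mod m g)).

(** [step Delta prev f]: [f] may be appended to a deduction from the hypotheses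
    [Delta] in which the formulas [prev] have already been derived. *)
Inductive step (I : Type) (Delta : Ensemble (formula I))
    (prev : list (formula I)) : formula I -> Prop :=
| step_hyp f : Ensembles.In _ Delta f -> step Delta prev f
| step_axiom f : axiom f -> step Delta prev f
| step_mp f g :
    List.In (f --> g) prev -> List.In f prev -> step Delta prev g
| step_mod m f : List.In f prev -> step Delta prev (Mod m f)
| step_or f g h :
    List.In (f --> h) prev -> List.In (g --> h) prev ->
    step Delta prev (f || g --> h).

(** Deductions are listed with the most recently derived formula first. *)
Inductive deduction (I : Type) (Delta : Ensemble (formula I)) :
    list (formula I) -> Prop :=
| deduction_nil : deduction Delta nil
| deduction_cons prev f :
    deduction Delta prev -> step Delta prev f -> deduction Delta (f :: prev).

Definition entails (I : Type) (Gamma : Ensemble (formula I)) (f : formula I) :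
    Prop :=
  exists Delta : Ensemble (formula I),
    Finite _ Delta /\ Included _ Delta Gamma /\
    exists prev, deduction Delta (f :: prev).

Fixpoint vars (I : Type) (f : formula I) : Ensemble nat :=
  match f with
  | Var v => Singleton _ v
  | Bot => Empty_set _
  | Or g h | Imp g h | Dot g h => Union _ (vars g) (vars h)
  | Mod _ g => vars g
  end.

Fixpoint subst (I : Type) (s : nat -> formula I) (f : formula I) : formula I :=
  match f with
  | Var v => s v
  | Bot => Bot
  | Or g h => subst s g || subst s h
  | Imp g h => subst s g --> subst s h
  | Dot g h => subst s g * subst s h
  | Mod m g => Mod m (subst s g)
  end.

Definition assign2 (I : Type) (p q : nat) (f g : formula I) (v : nat) :
    formula I :=
  if Nat.eqb v p then f else if Nat.eqb v q then g else Var v.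

Definition inst (I : Type) (p q : nat) (d : Ensemble (formula I))
    (f g : formula I) : Ensemble (formula I) :=
  Im _ _ d (subst (assign2 p q f g)).

(** The local deduction-detachment theorem for a relation [vd] between sets of
    formulas and formulas, with the sets d_j(p, q) written in the variables
    [p] and [q]. *)
Definition LDDT (I : Type) (vd : Ensemble (formula I) -> formula I -> Prop)
    (p q : nat) : Prop :=
  exists (J : Type) (d : J -> Ensemble (formula I)),
    (forall j f, Ensembles.In _ (d j) f -> Included _ (vars f) (Couple _ p q)) /\
    forall (Gamma : Ensemble (formula I)) (f g : formula I),
      vd (Ensembles.Add _ Gamma f) g <->
      exists j, forall h, Ensembles.In _ (inst p q (d j) f g) h -> vd Gamma h.

(* Main.v *)
Require Import Defs.
From Stdlib Require Import Classical_Prop.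

(** Call a formula a block over [f] when it is built from copies of [f] and of
    [Top] by products and modalities.  The theorem holds because [f] together
    with [Gamma] entails [g] exactly when [Gamma] alone entails [t --> g] for
    some block [t] over [f]; blocks are given by a shape independent of [f], so
    the shapes index the required family, each contributing one formula.

    Blocks are consequences of [f], since the logic has adjunction (from two
    formulas infer their product) and necessitation; this gives detachment
    ([proves_block]).  Conversely ([proves_deduction]), a derivation from
    [Gamma] and [f] is relativized rule by rule.  Modus ponens turns antecedents
    [s] and [t] into [s * t] by residuation, and necessitation turns [t] into
    [Mod m t] by the axiom distributing a modality over an implication; so the
    block depends on the derivation, and a whole family of shapes is used.
    The disjunction rule is the delicate case, since its relativization is not a
    rule of the calculus: it is recovered by absorbing the antecedent into both
    disjuncts, using distributivity of the product over the disjunction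
    ([proves_or_elim_under]). *)

Local Open Scope formula_scope.

(** * Derivations as trees *)

(** Finite deductions presented as trees: closure under rules and induction on
    derivations are then immediate, with no lists and no finite supports. *)
Inductive proves {I : Type} (Gamma : Ensemble (formula I)) : formula I -> Prop :=
| proves_hyp f : Ensembles.In _ Gamma f -> proves Gamma f
| proves_axiom f : axiom f -> proves Gamma f
| proves_mp f g : proves Gamma (f --> g) -> proves Gamma f -> proves Gamma g
| proves_mod m f : proves Gamma f -> proves Gamma (Mod m f)
| proves_or f g h :
    proves Gamma (f --> h) -> proves Gamma (g --> h) ->
    proves Gamma (f || g --> h).

Lemma deduction_proves {I} (Delta : Ensemble (formula I)) l :
  deduction Delta l -> forall f, List.In f l -> proves Delta f.
Proof.
  induction 1 as [|prev f _ IH st]; intros g Hg.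
  - destruct Hg.
  - destruct Hg as [<-|Hg]; [|now apply IH].
    destruct st as [f Hf|f Hf|f h Hi Hf|m f Hf|f h k H1 H2].
    + now apply proves_hyp.
    + now apply proves_axiom.
    + exact (proves_mp _ f h (IH _ Hi) (IH _ Hf)).
    + apply proves_mod; auto.
    + apply proves_or; auto.
Qed.

Lemma proves_mono {I} (Delta Gamma : Ensemble (formula I)) f :
  Included _ Delta Gamma -> proves Delta f -> proves Gamma f.
Proof.
  intros sub; induction 1.
  - now apply proves_hyp, sub.
  - now apply proves_axiom.
  - eapply proves_mp; eassumption.
  - now apply proves_mod.
  - now apply proves_or.
Qed.

Lemma step_mono {I} (Delta Delta' : Ensemble (formula I)) prev prev' f :
  Included _ Delta Delta' -> incl prev prev' ->
  step Delta prev f -> step Delta' prev' f.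
Proof.
  intros sD sp [g Hg|g Hg|g h Hi Hg|m g Hg|g h k H1 H2].
  - now apply step_hyp, sD.
  - now apply step_axiom.
  - apply step_mp with g; auto.
  - apply step_mod; auto.
  - apply step_or; auto.
Qed.

Lemma deduction_app {I} (D1 D2 Delta : Ensemble (formula I)) l1 l2 :
  Included _ D1 Delta -> Included _ D2 Delta ->
  deduction D1 l1 -> deduction D2 l2 -> deduction Delta (l1 ++ l2).
Proof.
  intros S1 S2 H1 H2; induction H1 as [|prev f _ IH st]; simpl.
  - induction H2 as [|prev f _ IH st]; constructor; trivial.
    apply step_mono with (2 := incl_refl _) (3 := st); trivial.
  - constructor; trivial.
    apply step_mono with (3 := st); [trivial|apply incl_appl, incl_refl].
Qed.

(** Working with a bound, and not with the union itself, avoids extensionality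
    of sets: [Finite] only covers sets that are literally obtained by adding new
    elements one at a time. *)
Lemma finite_upper_bound {U} (A B Gamma : Ensemble U) :
  Finite _ A -> Finite _ B -> Included _ A Gamma -> Included _ B Gamma ->
  exists C, Finite _ C /\ Included _ C Gamma /\
    Included _ A C /\ Included _ B C.
Proof.
  intros FA FB SA SB; induction FA as [|A FA IH x _].
  - exists B; split; [|split; [|split]]; trivial; intros y Hy; [destruct Hy|exact Hy].
  - destruct IH as (C & FC & SC & AC & BC).
    { intros y Hy; now apply SA, Union_introl. }
    destruct (classic (Ensembles.In _ C x)) as [Hx|Hx].
    + exists C; split; [|split; [|split]]; trivial.
      intros y [z Hz|z []]; auto.
    + exists (Ensembles.Add _ C x).
      split; [now apply Union_is_finite|split; [|split]].
      * intros y [z Hz|z []]; [auto|].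
        apply SA, Union_intror; constructor.
      * intros y [z Hz|z Hz]; [now apply Union_introl, AC|now apply Union_intror].
      * intros y Hy; now apply Union_introl, BC.
Qed.

(** Appending deductions of two premises gives a single deduction containing
    both, from a common finite support; one more step then applies a rule. *)
Lemma entails_step2 {I} (Gamma : Ensemble (formula I)) a b c :
  entails Gamma a -> entails Gamma b ->
  (forall Delta prev, List.In a prev -> List.In b prev -> step Delta prev c) ->
  entails Gamma c.
Proof.
  intros (D1 & F1 & S1 & l1 & H1) (D2 & F2 & S2 & l2 & H2) st.
  destruct (finite_upper_bound _ _ _ F1 F2 S1 S2) as (D & FD & SD & I1 & I2).
  exists D; split; [|split]; trivial.
  exists ((a :: l1) ++ (b :: l2)); constructor; [now apply deduction_app with D1 D2|].
  apply st; apply in_or_app; [left|right]; now left.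
Qed.

Lemma proves_entails {I} (Gamma : Ensemble (formula I)) f :
  proves Gamma f -> entails Gamma f.
Proof.
  induction 1 as [f Hf|f Hf|f g _ IH1 _ IH2|m f _ IH|f g h _ IH1 _ IH2].
  - exists (Ensembles.Add _ (Empty_set _) f); split; [|split].
    + apply Union_is_finite; [constructor|intros []].
    + intros x [y []|y []]; trivial.
    + exists nil; constructor; [constructor|].
      apply step_hyp, Union_intror; constructor.
  - exists (Empty_set _); split; [constructor|split].
    + intros x [].
    + exists nil; constructor; [constructor|now apply step_axiom].
  - apply (entails_step2 _ _ _ _ IH1 IH2); intros; now apply step_mp with f.
  - apply (entails_step2 _ _ _ _ IH IH); intros; now apply step_mod.
  - apply (entails_step2 _ _ _ _ IH1 IH2); intros; now apply step_or.
Qed.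

Lemma entails_iff_proves {I} (Gamma : Ensemble (formula I)) f :
  entails Gamma f <-> proves Gamma f.
Proof.
  split; [|apply proves_entails].
  intros (D & _ & sub & l & H).
  apply (proves_mono D); trivial.
  apply (deduction_proves _ _ H); now left.
Qed.

(** * Derived rules of the calculus *)

Section DerivedRules.
Context {I : Type} (Gamma : Ensemble (formula I)).
Implicit Types f g h s t : formula I.

Lemma proves_trans f g h :
  proves Gamma (f --> g) -> proves Gamma (g --> h) -> proves Gamma (f --> h).
Proof.
  intros H1 H2.
  apply (proves_mp _ (g --> h)); trivial.
  apply (proves_mp _ (f --> g)); trivial.
  apply proves_axiom, ax2.
Qed.

Lemma proves_curry f g h :
  proves Gamma (f * g --> h) -> proves Gamma (g --> f --> h).
Proof. apply proves_mp, proves_axiom, ax5. Qed.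

Lemma proves_uncurry f g h :
  proves Gamma (g --> f --> h) -> proves Gamma (f * g --> h).
Proof. apply proves_mp, proves_axiom, ax6. Qed.

Lemma proves_dot_comm f g : proves Gamma (f * g --> g * f).
Proof. apply proves_axiom, ax4. Qed.

Lemma proves_dot_l f g : proves Gamma (f * g --> f).
Proof. apply proves_axiom, ax3. Qed.

Lemma proves_dot_r f g : proves Gamma (f * g --> g).
Proof. exact (proves_trans _ _ _ (proves_dot_comm f g) (proves_dot_l g f)). Qed.

Lemma proves_top : proves Gamma Top.
Proof. apply proves_axiom, ax1. Qed.

Lemma proves_weaken f g : proves Gamma g -> proves Gamma (f --> g).
Proof. apply proves_mp, proves_curry, proves_dot_r. Qed.

(** Adjunction comes from currying [f * g --> f * g]. *)
Lemma proves_dot f g :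
  proves Gamma f -> proves Gamma g -> proves Gamma (f * g).
Proof.
  intros Hf Hg.
  apply (proves_mp _ f); trivial.
  apply (proves_mp _ g); trivial.
  apply proves_curry, proves_axiom, ax1.
Qed.

(** The two antecedents are multiplied rather than merged because the logic has
    no contraction. *)
Lemma proves_mp_under s t f g :
  proves Gamma (s --> f --> g) -> proves Gamma (t --> f) ->
  proves Gamma (s * t --> g).
Proof.
  intros Hs Ht.
  apply proves_uncurry, (proves_trans _ f); trivial.
  apply proves_curry.
  exact (proves_trans _ _ _ (proves_dot_comm s f) (proves_uncurry _ _ _ Hs)).
Qed.

Lemma proves_mod_under m t f :
  proves Gamma (t --> f) -> proves Gamma (Mod m t --> Mod m f).
Proof.
  intros H.
  apply (proves_mp _ (Mod m (t --> f))); [apply proves_axiom, ax12|].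
  now apply proves_mod.
Qed.

(** Residuation moves the antecedent next to the disjunction, and distributivity
    carries it into each disjunct, where the plain disjunction rule applies. *)
Lemma proves_or_elim_under s f g h :
  proves Gamma (s --> f --> h) -> proves Gamma (s --> g --> h) ->
  proves Gamma (s --> f || g --> h).
Proof.
  intros Hf Hg.
  assert (swap : forall k, proves Gamma (s --> k --> h) ->
                           proves Gamma (s * k --> h)).
  { intros k Hk.
    exact (proves_trans _ _ _ (proves_dot_comm s k) (proves_uncurry _ _ _ Hk)). }
  apply proves_curry.
  apply (proves_trans _ (s * (f || g))); [apply proves_dot_comm|].
  apply (proves_trans _ (s * f || s * g)); [apply proves_axiom, ax9|].
  apply proves_or; now apply swap.
Qed.

End DerivedRules.

(** * Blocks and the local deduction theorem *)

Inductive shape (I : Type) : Type :=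
| Hole : shape I
| One : shape I
| Prod : shape I -> shape I -> shape I
| Nec : I -> shape I -> shape I.

Arguments Hole {I}.
Arguments One {I}.
Arguments Prod {I} _ _.
Arguments Nec {I} _ _.

Fixpoint block {I : Type} (j : shape I) (f : formula I) : formula I :=
  match j with
  | Hole => f
  | One => Top
  | Prod j1 j2 => block j1 f * block j2 f
  | Nec m j1 => Mod m (block j1 f)
  end.

Lemma proves_block {I} (Gamma : Ensemble (formula I)) f j :
  proves Gamma f -> proves Gamma (block j f).
Proof.
  intros Hf; induction j; simpl.
  - exact Hf.
  - apply proves_top.
  - now apply proves_dot.
  - now apply proves_mod.
Qed.

(** Each rule of the calculus is applied underneath a block antecedent, and
    blocks are closed under the operations on antecedents that this requires. *)
Lemma proves_deduction {I} (Gamma : Ensemble (formula I)) f g :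
  proves (Ensembles.Add _ Gamma f) g -> exists j, proves Gamma (block j f --> g).
Proof.
  induction 1 as [h Hh|h Hh|h k _ [j1 H1] _ [j2 H2]|m h _ [j H]
                 |h k l _ [j1 H1] _ [j2 H2]].
  - destruct Hh as [h Hh|h Hh].
    + exists One; now apply proves_weaken, proves_hyp.
    + destruct Hh; exists Hole; apply proves_axiom, ax1.
  - exists One; now apply proves_weaken, proves_axiom.
  - exists (Prod j1 j2); now apply proves_mp_under with h.
  - exists (Nec m j); now apply proves_mod_under.
  - exists (Prod j1 j2); simpl; apply proves_or_elim_under.
    + exact (proves_trans _ _ _ _ (proves_dot_l _ _ _) H1).
    + exact (proves_trans _ _ _ _ (proves_dot_r _ _ _) H2).
Qed.

Lemma vars_block {I} (j : shape I) p :
  Included _ (vars (block j (Var p))) (Singleton _ p).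
Proof.
  induction j as [| |j1 IH1 j2 IH2|m j IH]; simpl; trivial.
  - intros x Hx; exact Hx.
  - intros x [y []|y []].
  - intros x [y Hy|y Hy]; auto.
Qed.

Lemma subst_block {I} (s : nat -> formula I) j f :
  subst s (block j f) = block j (subst s f).
Proof. induction j; simpl; [reflexivity|reflexivity|congruence|congruence]. Qed.

Theorem corollary6p9 (I : Type) (I_nonempty : inhabited I)
    (p q : nat) (p_neq_q : p <> q) :
  LDDT (@entails I) p q.
Proof.
  exists (shape I), (fun j => Singleton _ (block j (Var p) --> Var q)).
  split.
  - intros j f Hf; destruct Hf.
    intros x [y Hy|y Hy].
    + apply vars_block in Hy; destruct Hy; constructor.
    + destruct Hy; constructor.
  - intros Gamma f g.
    assert (inst_eq : forall j,
      subst (assign2 p q f g) (block j (Var p) --> Var q) = (block j f --> g)).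
    { intros j; simpl; rewrite subst_block; simpl; unfold assign2.
      rewrite !PeanoNat.Nat.eqb_refl.
      now rewrite (proj2 (PeanoNat.Nat.eqb_neq q p) (not_eq_sym p_neq_q)). }
    split.
    + intros H; apply entails_iff_proves, proves_deduction in H.
      destruct H as [j Hj]; exists j.
      intros h [k Hk y ->]; destruct Hk.
      rewrite inst_eq; now apply entails_iff_proves.
    + intros [j Hj]; apply entails_iff_proves.
      apply (proves_mp _ (block j f)).
      * apply (proves_mono Gamma); [intros x Hx; now apply Union_introl|].
        apply entails_iff_proves, Hj.
        rewrite <- inst_eq; apply Im_def; constructor.
      * apply proves_block, proves_hyp, Union_intror; constructor.
Qed.
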